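(* Let $d\ge3$ and consider $\Omega_\varepsilon$ with perturbation $\rho=Y_{p',q'}$ (i.e. $A_{p,q}=\delta_{p,p'}\delta_{q,q'}$). For every $k\in\mathbb{Z}^+$ and every $j=1,\dots,N(d,k)$, with $\lambda^{(1)}_{k,j}$ the first-order coefficients of the Steklov eigenvalue branches emanating from $k$ (i.e. the eigenvalues of $M^{(d,k)}$): (1) if $p'=0$ (so $\rho=Y_{0,1}=|S^d|^{-1/2}$ is constant), then $\lambda^{(1)}_{k,j}=-k|S^d|^{-1/2}$; (2) if $p'$ is odd, then $\lambda^{(1)}_{k,j}=0$, i.e. the Steklov eigenvalue $\lambda^\varepsilon_{k,j}$ is unperturbed at first order in $\varepsilon$.
   Context: Hyperspherical coordinates on $\mathbb{R}^{d+1}$; $\nabla_{S^d}$ the gradient on $S^d$, $d\sigma_d$ the surface measure, $|S^d|$ the surface area. $N(d,0)=1$, $N(d,\ell)=\binom{d+\ell}{d}-\binom{d+\ell-2}{d}$ for $\ell\ge1$. $\{Y_k^m\}$ is an orthonormal basis of complex degree-$k$ spherical harmonics, $\{Y_{p,q}\}_{q=1}^{N(d,p)}$ an orthonormal basis of real degree-$p$ spherical harmonics with $Y_{0,1}=|S^d|^{-1/2}$. For real $\rho\in C^1(S^d)$, $\Omega_\varepsilon=\{(r,\hat\theta):0\le r\le1+\varepsilon\rho(\hat\theta)\}$. The Steklov eigenvalues of $\Omega_\varepsilon$ near $k$ (of which there are $N(d,k)$ with multiplicity) have expansions $\lambda^\varepsilon_{k,j}=k+\varepsilon\lambda^{(1)}_{k,j}+O(\varepsilon^2)$,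 where $\lambda^{(1)}_{k,1}\le\cdots\le\lambda^{(1)}_{k,N(d,k)}$ are the eigenvalues of the Hermitian matrix $M^{(d,k)}_{m,n}=-\int_{S^d}k\rho\,Y_k^m\overline{Y_k^n}\,d\sigma_d-\int_{S^d}(\nabla_{S^d}\rho\cdot\nabla_{S^d}Y_k^m)\overline{Y_k^n}\,d\sigma_d$. *)

(* Defs.v *)
(* MathComp-Analysis (R : realType) + real_closed complex numbers R[i]. *)
From HB Require Import structures.
From mathcomp Require Import all_boot all_order all_algebra.
From mathcomp Require Import all_classical all_reals all_analysis.
From mathcomp Require Import complex.
Set Implicit Arguments. Unset Strict Implicit. Unset Printing Implicit Defensive.
Import Order.TTheory GRing.Theory Num.Theory.
Local Open Scope ring_scope.
Local Open Scope complex_scope.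

Section SphereDefs.
Variable R : realType.

(* Points of R^{n} are row vectors 'rV[R]_n. *)

(* N(d,l) = dimension of degree-l spherical harmonics on S^d *)
Definition Ndim (d l : nat) : nat :=
  match l with
  | 0 => 1
  | l'.+1 => 'C(d + l, d) - 'C(d + l - 2, d)
  end.

(* Surface integral over S^d (embedded in R^{d+1}), written in hyperspherical
   coordinates:  S^0 = {+1,-1} with counting measure, and
   x = (cos phi, sin phi * y), y in S^d, dsigma_{d+1} = sin^d phi dphi dsigma_d. *)
Fixpoint sph_int (d : nat) : ('rV[R]_d.+1 -> R) -> R :=
  match d return ('rV[R]_d.+1 -> R) -> R with
  | 0 => fun f => f (const_mx 1) + f (const_mx (-1))
  | d'.+1 => fun f =>
      Rintegral (@lebesgue_measure R) [set t : R | 0 <= t <= pi]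
        (fun phi : R => sin phi ^+ d' *
           @sph_int d' (fun y => f (row_mx (cos phi)%:M (sin phi *: y))))
  end.
Arguments sph_int : clear implicits.

(* surface area |S^d| *)
Definition sph_area (d : nat) : R := sph_int d (fun _ => 1).

(* integral of a complex valued function over S^d *)
Definition sph_intC (d : nat) (f : 'rV[R]_d.+1 -> R[i]) : R[i] :=
  (sph_int d (fun x => complex.Re (f x))) +i* (sph_int d (fun x => complex.Im (f x))).

Definition on_sphere (n : nat) (x : 'rV[R]_n) : Prop := \sum_i x 0 i ^+ 2 = 1.

Definition eucl_norm (n : nat) (x : 'rV[R]_n) : R := Num.sqrt (\sum_i x 0 i ^+ 2).

(* partial derivative in the i-th coordinate direction *)
Definition partial (n : nat) (i : 'I_n) (g : 'rV[R]_n -> R) : 'rV[R]_n -> R :=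
  fun x => derive1 (fun t : R => g (x + t *: delta_mx 0 i)) 0.

Definition laplacian (n : nat) (g : 'rV[R]_n -> R) : 'rV[R]_n -> R :=
  fun x => \sum_i partial i (partial i g) x.

(* gradient on the sphere: gradient of the 0-homogeneous extension x |-> f (x/|x|) *)
Definition sph_grad (n : nat) (f : 'rV[R]_n -> R) (i : 'I_n) : 'rV[R]_n -> R :=
  partial i (fun z => f ((eucl_norm z)^-1 *: z)).

(* homogeneous polynomial function of degree k on R^n with coefficients c *)
Definition hpoly_fun (T : comNzRingType) (emb : R -> T) (n k : nat)
  (c : {ffun 'I_n -> 'I_k.+1} -> T) (x : 'rV[R]_n) : T :=
  \sum_(a : {ffun 'I_n -> 'I_k.+1} | \sum_i (a i : nat) == k)
     c a * \prod_i (emb (x 0 i)) ^+ a i.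

(* real spherical harmonic of degree k on S^d: restriction to S^d of a
   harmonic homogeneous polynomial of degree k on R^{d+1} *)
Definition real_sph_harm (d k : nat) (Y : 'rV[R]_d.+1 -> R) : Prop :=
  exists c : {ffun 'I_d.+1 -> 'I_k.+1} -> R,
    (forall x, laplacian (hpoly_fun id c) x = 0) /\
    (forall x, on_sphere x -> Y x = hpoly_fun id c x).

Arguments real_sph_harm : clear implicits.

(* complex spherical harmonic of degree k on S^d *)
Definition cplx_sph_harm (d k : nat) (Y : 'rV[R]_d.+1 -> R[i]) : Prop :=
  exists c : {ffun 'I_d.+1 -> 'I_k.+1} -> R[i],
    (forall x, laplacian (fun z => complex.Re (hpoly_fun (fun r => r%:C) c z)) x = 0) /\
    (forall x, laplacian (fun z => complex.Im (hpoly_fun (fun r => r%:C) c z)) x = 0) /\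
    (forall x, on_sphere x -> Y x = hpoly_fun (fun r => r%:C) c x).

Arguments cplx_sph_harm : clear implicits.

(* {Y_{p,q}}_q is an orthonormal basis of real degree-p spherical harmonics *)
Definition real_ONB (d p : nat) (Y : 'I_(Ndim d p) -> 'rV[R]_d.+1 -> R) : Prop :=
  (forall q, real_sph_harm d p (Y q)) /\
  (forall q q', sph_int d (fun x => Y q x * Y q' x) = (q == q')%:R) /\
  (forall Z, real_sph_harm d p Z -> exists a : 'I_(Ndim d p) -> R,
       forall x, on_sphere x -> Z x = \sum_q a q * Y q x).

Arguments real_ONB : clear implicits.

(* {Y_k^m}_m is an orthonormal basis of complex degree-k spherical harmonics *)
Definition cplx_ONB (d k : nat) (Y : 'I_(Ndim d k) -> 'rV[R]_d.+1 -> R[i]) : Prop :=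
  (forall m, cplx_sph_harm d k (Y m)) /\
  (forall m n, sph_intC (fun x => Y m x * (Y n x)^*) = (m == n)%:R) /\
  (forall Z, cplx_sph_harm d k Z -> exists a : 'I_(Ndim d k) -> R[i],
       forall x, on_sphere x -> Z x = \sum_m a m * Y m x).

(* (grad_{S^d} rho . grad_{S^d} Y)(x) for real rho and complex Y *)
Definition sph_grad_dot (d : nat) (rho : 'rV[R]_d.+1 -> R) (Y : 'rV[R]_d.+1 -> R[i])
  (x : 'rV[R]_d.+1) : R[i] :=
  \sum_i (sph_grad rho i x)%:C *
     ((sph_grad (fun z => complex.Re (Y z)) i x) +i* (sph_grad (fun z => complex.Im (Y z)) i x)).

(* the matrix M^{(d,k)} *)
Definition Mmat (d k : nat) (rho : 'rV[R]_d.+1 -> R)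
  (Y : 'I_(Ndim d k) -> 'rV[R]_d.+1 -> R[i]) : 'M[R[i]]_(Ndim d k) :=
  \matrix_(m, n)
    (- sph_intC (fun x => (k%:R * rho x)%:C * Y m x * (Y n x)^*)
     - sph_intC (fun x => sph_grad_dot rho (Y m) x * (Y n x)^*)).

End SphereDefs.

Arguments sph_int {R} d f.
Arguments sph_area R d.
Arguments sph_intC {R} d f.
Arguments real_sph_harm {R} d k Y.
Arguments cplx_sph_harm {R} d k Y.
Arguments real_ONB {R} d p Y.
Arguments cplx_ONB {R} d k Y.
Arguments Mmat {R} d k rho Y.

(* Main.v *)
(** The antipode x |-> -x preserves the surface measure and multiplies a degree-p
    harmonic by (-1)^p; a spherical gradient picks up one more sign.  Hence for p'
    odd both integrands of M_{m,n} are odd, whatever k is, because Y_k^m and the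
    conjugate of Y_k^n contribute the same sign (-1)^k twice; so M = 0.  For rho
    constant the gradient term vanishes and orthonormality makes M scalar. *)

Require Import Defs.
From HB Require Import structures.
From mathcomp Require Import all_boot all_order all_algebra.
From mathcomp Require Import all_classical all_reals all_analysis.
From mathcomp Require Import measurable_realfun complex ring lra.
Set Implicit Arguments. Unset Strict Implicit. Unset Printing Implicit Defensive.
Import Order.TTheory GRing.Theory Num.Theory.
Local Open Scope ring_scope.
Local Open Scope complex_scope.

(** * Integrals of arbitrary functions *)

(* The integral of a nonnegative function is a supremum over simple functions
   below it, so invariance and homogeneity hold without measurability.  This
   spares proving that the inner integrals in [sph_int] are measurable. *)
Section IntegralWithoutMeasurability.
Local Open Scope classical_set_scope.
Context d (T : measurableType d) (R : realType).
Variable mu : {measure set T -> \bar R}.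
Import HBNNSimple.

Section Comp.
Variables (h : {nnsfun T >-> R}) (r : T -> T).
Hypothesis mr : measurable_fun setT r.

(** Composites with [r] are the competitors in the supremum defining the integral of [f \o r], so
    they must carry the structure of a simple function. *)
Definition nnsfun_comp : T -> R := h \o r.

Lemma nnsfun_comp_measurable : measurable_fun setT nnsfun_comp.
Proof. by apply: measurableT_comp. Qed.

Lemma nnsfun_comp_finite : finite_set (range nnsfun_comp).
Proof.
apply: (@sub_finite_set _ _ (range h)); last exact: fimfunP.
by move=> _ [x _ <-]; exists (r x).
Qed.

Lemma nnsfun_comp_ge0 x : 0 <= nnsfun_comp x.
Proof. exact: fun_ge0. Qed.

HB.instance Definition _ :=
  isMeasurableFun.Build _ _ _ _ nnsfun_comp nnsfun_comp_measurable.
HB.instance Definition _ := FiniteImage.Build _ _ nnsfun_comp nnsfun_comp_finite.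
HB.instance Definition _ := isNonNegFun.Build _ _ nnsfun_comp nnsfun_comp_ge0.

Definition comp_nnsfun : {nnsfun T >-> R} := nnsfun_comp.
End Comp.

Local Open Scope ereal_scope.

(** A simple [h] below [f] gives [h \o r] below [f \o r], with the same integral because its level
    sets are preimages under [r] of those of [h]. *)
Lemma ge0_integral_involution_le (r : T -> T) (f : T -> \bar R) :
    measurable_fun setT r ->
    (forall A, measurable A -> mu (r @^-1` A) = mu A) ->
    (forall x, 0 <= f x) ->
  \int[mu]_x f x <= \int[mu]_x f (r x).
Proof.
move=> mr mur f0; rewrite !ge0_integralTE//.
apply: ge_ereal_sup => _ [h /= hf <-].
apply: ereal_sup_ubound; exists (comp_nnsfun h mr) => /=.
  by move=> x; exact: hf.
rewrite !sintegralET; apply: eq_fsbigr => x _; congr (_ * _).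
rewrite -[RHS]mur//.
Qed.

(** For nonnegative functions the reverse inequality is the previous one at [f \o r], since [r] is
    its own inverse. Signed functions follow by splitting into positive and negative parts. *)
Lemma integral_involution (r : T -> T) (f : T -> \bar R) :
    measurable_fun setT r ->
    (forall A, measurable A -> mu (r @^-1` A) = mu A) -> involutive r ->
  \int[mu]_x f (r x) = \int[mu]_x f x.
Proof.
move=> mr mur rK.
have ge0E (g : T -> \bar R) : (forall x, 0 <= g x) ->
    \int[mu]_x g (r x) = \int[mu]_x g x.
  move=> g0; apply/eqP; rewrite eq_le; apply/andP; split; last first.
    exact: ge0_integral_involution_le.
  have -> : \int[mu]_x g x = \int[mu]_x g (r (r x)).
    by apply: eq_integral => x _; rewrite rK.
  by apply: (@ge0_integral_involution_le r (g \o r)) => //= x; exact: g0.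
rewrite integralE [RHS]integralE; congr (_ - _).
- by rewrite -(ge0E _ (funepos_ge0 f)) -[fun x => f (r x)]/(f \o r) funepos_comp.
- by rewrite -(ge0E _ (funeneg_ge0 f)) -[fun x => f (r x)]/(f \o r) funeneg_comp.
Qed.

Lemma ge0_integralZl_le (a : R) (f : T -> \bar R) :
    (0 < a)%R -> (forall x, 0 <= f x) ->
  a%:E * \int[mu]_x f x <= \int[mu]_x (a%:E * f x).
Proof.
move=> a0 f0.
have af0 x : 0 <= a%:E * f x by rewrite mule_ge0 // lee_fin ltW.
rewrite -lee_pdivlMl// !ge0_integralTE//.
apply: ge_ereal_sup => _ [h /= hf <-]; rewrite lee_pdivlMl// -sintegralrM.
apply: ereal_sup_ubound; exists (scale_nnsfun h (ltW a0)) => //= x.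
by rewrite EFinM lee_pmul2l.
Qed.

(** The reverse inequality is the previous lemma with [a^-1] as factor. *)
Lemma ge0_integralZl_pos (a : R) (f : T -> \bar R) :
    (0 < a)%R -> (forall x, 0 <= f x) ->
  \int[mu]_x (a%:E * f x) = a%:E * \int[mu]_x f x.
Proof.
move=> a0 f0; apply/eqP; rewrite eq_le ge0_integralZl_le// andbT.
rewrite -lee_pdivrMl//.
have ai0 : (0 < a^-1)%R by rewrite invr_gt0.
apply: le_trans (ge0_integralZl_le ai0 _) _.
  by move=> x; rewrite mule_ge0 // lee_fin ltW.
rewrite le_eqVlt; apply/orP; left; apply/eqP/eq_integral => x _.
by rewrite muleA -EFinM mulVf ?mul1e// gt_eqF.
Qed.

(* When both parts are infinite, [fine] sends both sides to the junk value 0. *)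
Lemma RintegralZl_total (D : set T) (a : R) (f : T -> R) :
  Rintegral mu D (fun x => a * f x)%R = (a * Rintegral mu D f)%R.
Proof.
rewrite Rintegral_mkcond [in RHS]Rintegral_mkcond.
have -> : patch (fun=> 0%R) D (fun x => a * f x)%R =
    (fun x => a * patch (fun=> 0%R) D f x)%R.
  by apply/funext => x; rewrite /patch; case: ifP => //; rewrite mulr0.
move: (patch _ D f) => {D}{}f.
have pos (b : R) : (0 < b)%R ->
    (Rintegral mu setT (fun x => b * f x) = b * Rintegral mu setT f)%R.
  move=> b0; rewrite /Rintegral integralE [X in (b * fine X)%R]integralE.
  have -> : \int[mu]_x (fun x => (b * f x)%:E)^\+ x
      = b%:E * \int[mu]_x (EFin \o f)^\+ x.
    by rewrite -ge0_integralZl_pos// -ge0_funeposM ?ltW.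
  have -> : \int[mu]_x (fun x => (b * f x)%:E)^\- x
      = b%:E * \int[mu]_x (EFin \o f)^\- x.
    by rewrite -ge0_integralZl_pos// -ge0_funenegM ?ltW.
  have := integral_ge0 mu (D := setT) (fun x _ => funepos_ge0 (EFin \o f) x).
  have := integral_ge0 mu (D := setT) (fun x _ => funeneg_ge0 (EFin \o f) x).
  (* If either part is infinite, so is the difference, and [fine] returns 0 on both sides. *)
  case: (integral _ _ _) => [v||]//; case: (integral _ _ _) => [u||]// _ _;
    rewrite ?gt0_muley ?lte_fin//= ?mulr0//.
  by rewrite -mulrBr.
(* Negation swaps the positive and negative parts; this reduces negative factors to positive
   ones. *)
have neg (g : T -> R) :
    (Rintegral mu setT (fun x => - g x) = - Rintegral mu setT g)%R.
  rewrite /Rintegral integralE [X in (- fine X)%R]integralE.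
  have -> : (fun x => (- g x)%R%:E) = \- (EFin \o g) by [].
  rewrite funeposN funenegN.
  have := integral_ge0 mu (D := setT) (fun x _ => funepos_ge0 (EFin \o g) x).
  have := integral_ge0 mu (D := setT) (fun x _ => funeneg_ge0 (EFin \o g) x).
  case: (integral _ _ _) => [v||]//; case: (integral _ _ _) => [u||]//= _ _;
    by rewrite ?oppr0 ?opprB.
have [a0|a0|->] := ltgtP a 0%R; last 2 first.
- exact: pos.
- rewrite mul0r -[RHS](_ : Rintegral mu setT (cst 0) = 0)%R.
    by apply: eq_Rintegral => x _; rewrite mul0r.
  by rewrite /Rintegral integral0.
- rewrite -[a]opprK mulNr -pos ?oppr_gt0// -neg.
  by apply: eq_Rintegral => x _; rewrite mulNr.
Qed.

End IntegralWithoutMeasurability.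

(** * Reflection of the interval from 0 to [c] *)

Section Reflection.
Local Open Scope classical_set_scope.
Context {R : realType}.
Local Notation mu := (@lebesgue_measure R).

(** By uniqueness of Lebesgue measure, half-open intervals suffice: reflection moves the closed end
    to the other side and keeps the length. *)
Lemma lebesgue_measure_reflect (c : R) (A : set (measurableTypeR R)) :
  measurable A -> mu ((fun t : measurableTypeR R => c - t) @^-1` A) = mu A.
Proof.
pose r := fun t : measurableTypeR R => c - t : measurableTypeR R.
have mr : measurable_fun setT r by exact: measurable_funB.
move=> mA; apply/esym.
apply: (@lebesgue_measure_unique R (pushforward mu r)) => //= _ [[a b]] _ <-.
rewrite /pushforward.
have -> : (fun t : R => c - t) @^-1` `]a, b] = `[c - b, c - a[.
  by apply/seteqP; split => x /=; rewrite !in_itv/= => /andP[? ?];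
    apply/andP; split; lra.
rewrite !lebesgue_measure_itv/= !lte_fin.
have -> : (c - b < c - a) = (a < b) by rewrite ltrD2l ltrN2.
by case: ifP => // _; rewrite -!EFinB; congr EFin; ring.
Qed.

Lemma Rintegral_reflect (c : R) (f : R -> R) :
  Rintegral mu [set t : R | 0 <= t <= c] (fun t => f (c - t)) =
  Rintegral mu [set t : R | 0 <= t <= c] f.
Proof.
rewrite Rintegral_mkcond [RHS]Rintegral_mkcond /Rintegral; congr fine.
pose r := fun t : measurableTypeR R => c - t : measurableTypeR R.
rewrite -[RHS](@integral_involution _ _ _ _ r).
- apply: eq_integral => x _; rewrite /patch.
  have -> // : (r x \in [set t | 0 <= t <= c]) = (x \in [set t | 0 <= t <= c]).
  by apply/idP/idP; rewrite !inE/= /r => /andP[? ?]; apply/andP; split; lra.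
- exact: measurable_funB.
- exact: lebesgue_measure_reflect.
- by move=> x; rewrite /r subKr.
Qed.
End Reflection.

(** * Spherical gradients and the antipode *)

Section SphericalGradient.
Context {R : realType}.
Local Open Scope classical_set_scope.
Import numFieldNormedType.Exports.

Lemma dnbhs0_oppr (T : Type) (D : R -> T) :
  D (- h) @[h --> (0 : R)^'] = D h @[h --> (0 : R)^'].
Proof.
rewrite -[in RHS]oppr0 dnbhsN; apply/seteqP; split => A /=.
  move=> DA; exists [set h | A (D (- h))] => //; apply/seteqP; split => h /=.
    by move=> [k Ak <-].
  by move=> Ah; exists (- h); rewrite ?opprK.
move=> [B nB BE].
apply: filterS nB => h Bh /=.
suff : ([eta D] @^-1` A) (- h) by [].
by rewrite -BE; exists h.
Qed.

(* A divergent limit is the junk value 0, so convergence is not needed. *)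
Lemma limZ_total (c : R) (D : R -> R) (F : set_system R) :
    ProperFilter F -> c != 0 ->
  lim (c * D h @[h --> F]) = c * lim (D h @[h --> F]).
Proof.
move=> PF c0; have [cD|dD] := pselect (cvg (D h @[h --> F])).
  by apply: cvg_lim => //; apply: cvgMl_tmp.
have dcD : ~ cvg (c * D h @[h --> F]).
  move=> cD; apply: dD.
  have -> : D = fun h => c^-1 * (c * D h).
    by apply/funext => h; rewrite mulKf.
  exact: is_cvgMl_tmp cD.
rewrite (dvgP dD) (dvgP dcD).
by rewrite [RHS]mulr0.
Qed.

(** The difference quotient at [h] is [- c] times that of [g] at [- h]. *)
Lemma derive1_reflect (c : R) (g : R -> R) : c != 0 ->
  derive1 (fun t => c * g (- t)) 0 = - c * derive1 g 0.
Proof.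
move=> c0; rewrite /derive1.
rewrite -[in RHS](dnbhs0_oppr (fun h => h^-1 *: (g (h + 0) - g 0))).
rewrite -limZ_total ?oppr_eq0//.
have -> // : (fun h : R => h^-1 *: (c * g (- (h + 0)) - c * g (- 0))) =
    (fun h => - c * ((- h)^-1 *: (g (- h + 0) - g 0))).
by apply/funext => h; rewrite !addr0 oppr0 /GRing.scale/= invrN; ring.
Qed.

Lemma eucl_normN n (z : 'rV[R]_n) : eucl_norm (- z) = eucl_norm z.
Proof.
by congr Num.sqrt; apply: eq_bigr => i _; rewrite mxE sqrrN.
Qed.

Lemma on_sphereN n (x : 'rV[R]_n) : on_sphere x -> on_sphere (- x).
Proof.
by rewrite /on_sphere => <-; apply: eq_bigr => i _; rewrite mxE sqrrN.
Qed.

Lemma on_sphere_normalize n (z : 'rV[R]_n) :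
  z != 0 -> on_sphere ((eucl_norm z)^-1 *: z).
Proof.
move=> z0; rewrite /on_sphere.
under eq_bigr do rewrite mxE exprMn.
have s0 : 0 <= \sum_i z 0 i ^+ 2 by apply: sumr_ge0 => i _; exact: sqr_ge0.
rewrite -mulr_sumr exprVn sqr_sqrtr// mulVf//.
apply: contra z0 => /eqP sz; apply/eqP/rowP => i; rewrite mxE.
have /eqP : z 0 i ^+ 2 = 0.
  by apply: (psumr_eq0P _ sz) => // j _; exact: sqr_ge0.
by rewrite sqrf_eq0 => /eqP.
Qed.

(** Away from the origin, normalized points lie on the sphere, where the assumptions on the function
    inside [sph_grad] apply. *)
Lemma near_line_neq0 n (x : 'rV[R]_n) (i : 'I_n) :
  on_sphere x -> \forall t \near (0 : R), x + t *: delta_mx 0 i != 0.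
Proof.
move=> xS; have [j xj0] : exists j, x 0 j != 0.
  apply/not_existsP => x0; have := oner_neq0 R; rewrite -xS big1 ?eqxx// => j _.
  by have /negP/negPn/eqP -> := x0 j; rewrite expr0n.
(* For [t] smaller in absolute value than [x 0 j], the [j]-th coordinate cannot cancel. *)
have : 0 < `|x 0 j| by rewrite normr_gt0.
move=> /(nbhs0_lt (V := R^o)); apply: filterS => t tx; apply/eqP => /rowP/(_ j).
rewrite !mxE eqxx/=; case: eqP => _ /=; last first.
  by rewrite mulr0 addr0; exact/eqP.
by rewrite mulr1 => /eqP; rewrite addr_eq0 => /eqP xt; rewrite xt normrN ltxx in tx.
Qed.

Lemma near_eq_derive1 (f g : R -> R) (a : R) :
  (\forall t \near a, f t = g t) -> derive1 f a = derive1 g a.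
Proof. by move=> fg; rewrite !derive1E; exact: near_eq_derive. Qed.

(** The antipode reverses the line along which [f] is differentiated, hence the sign in front of the
    parity factor [c]. *)
Lemma sph_gradN n (f : 'rV[R]_n -> R) (c : R) (i : 'I_n) (x : 'rV[R]_n) :
    c != 0 -> (forall y, on_sphere y -> f (- y) = c * f y) -> on_sphere x ->
  sph_grad f i (- x) = - c * sph_grad f i x.
Proof.
move=> c0 fN xS; rewrite /sph_grad /partial -derive1_reflect//.
apply: near_eq_derive1.
have := near_line_neq0 i (on_sphereN xS); apply: filterS => t xt0.
have -> : x + - t *: delta_mx 0 i = - (- x + t *: delta_mx 0 i).
  by rewrite opprD opprK scaleNr.
rewrite eucl_normN scalerN -fN ?opprK//.
exact/on_sphereN/on_sphere_normalize.
Qed.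

Lemma sph_grad_cst n (f : 'rV[R]_n -> R) (a : R) (i : 'I_n) (x : 'rV[R]_n) :
  (forall y, on_sphere y -> f y = a) -> on_sphere x -> sph_grad f i x = 0.
Proof.
move=> fa xS; rewrite /sph_grad /partial -[RHS](derive1_cst a (0 : R)).
apply: near_eq_derive1; have := near_line_neq0 i xS; apply: filterS => t xt0.
by rewrite fa//; exact: on_sphere_normalize.
Qed.

End SphericalGradient.

(** * The surface integral *)

Section SphereIntegral.
Context {R : realType}.

Lemma on_sphere_row d (phi : R) (y : 'rV[R]_d.+1) : on_sphere y ->
  on_sphere (row_mx (cos phi)%:M (sin phi *: y) : 'rV[R]_d.+2).
Proof.
move=> yS; rewrite /on_sphere (@big_split_ord _ _ _ 1 d.+1) big_ord1.
rewrite (@row_mxEl _ 1 1 d.+1) mxE eqxx mulr1n.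
rewrite (eq_bigr (fun i => sin phi ^+ 2 * y 0 i ^+ 2)); last first.
  by move=> i _; rewrite (@row_mxEr _ 1 1 d.+1) mxE exprMn.
rewrite -mulr_sumr yS mulr1; exact: cos2Dsin2.
Qed.

Lemma eq_sph_int d (f g : 'rV[R]_d.+1 -> R) :
  (forall x, on_sphere x -> f x = g x) -> sph_int d f = sph_int d g.
Proof.
elim: d f g => [|d IH] f g fg /=.
  by rewrite !fg// /on_sphere big_ord1 mxE ?sqrrN expr1n.
apply: eq_Rintegral => phi _; congr (_ * _); apply: IH => y yS.
exact/fg/on_sphere_row.
Qed.

Lemma sph_intZ d (a : R) (f : 'rV[R]_d.+1 -> R) :
  sph_int d (fun x => a * f x) = a * sph_int d f.
Proof.
elim: d f => [|d IH] f /=; first by rewrite mulrDr.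
rewrite -RintegralZl_total; apply: eq_Rintegral => phi _.
by rewrite IH mulrCA.
Qed.

(** In hyperspherical coordinates the antipode sends [phi] to [pi - phi] and [y] to [- y]: the first
    is a reflection preserving [sin phi], the second is the induction hypothesis. *)
Lemma sph_int_antipode d (f : 'rV[R]_d.+1 -> R) :
  sph_int d (fun x => f (- x)) = sph_int d f.
Proof.
elim: d f => [|d IH] f /=.
  have -> : - const_mx 1 = const_mx (-1) :> 'rV[R]_1 by apply/rowP => i; rewrite !mxE.
  have -> : - const_mx (-1) = const_mx 1 :> 'rV[R]_1.
    by apply/rowP => i; rewrite !mxE opprK.
  by rewrite addrC.
rewrite -[RHS]Rintegral_reflect; apply: eq_Rintegral => phi _.
have -> : sin (pi - phi) = sin phi by rewrite sinB sinpi cospi; ring.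
have -> : cos (pi - phi) = - cos phi by rewrite cosB sinpi cospi; ring.
rewrite -[in RHS]IH; congr (_ * _); apply: eq_sph_int => y _; congr f.
have -> : (- cos phi)%:M = - (cos phi)%:M :> 'M[R]_1.
  by apply/matrixP => i j; rewrite !mxE mulNrn.
by rewrite scalerN; exact: (@opp_row_mx R 1 1 d.+1).
Qed.

Lemma sph_int_odd d (f : 'rV[R]_d.+1 -> R) :
  (forall x, on_sphere x -> f (- x) = - f x) -> sph_int d f = 0.
Proof.
move=> fN; have : sph_int d f = - sph_int d f; last by lra.
rewrite -{1}sph_int_antipode -[RHS]mulN1r -sph_intZ.
by apply: eq_sph_int => x /fN ->; rewrite mulN1r.
Qed.

Lemma eq_sph_intC d (f g : 'rV[R]_d.+1 -> R[i]) :
  (forall x, on_sphere x -> f x = g x) -> sph_intC d f = sph_intC d g.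
Proof.
by move=> fg; congr (_ +i* _); apply: eq_sph_int => x xS; rewrite fg.
Qed.

Lemma sph_intCZ d (a : R) (f : 'rV[R]_d.+1 -> R[i]) :
  sph_intC d (fun x => a%:C * f x) = a%:C * sph_intC d f.
Proof.
rewrite [RHS]/GRing.mul/= !mul0r subr0 addr0 -!sph_intZ.
by congr (_ +i* _); apply: eq_sph_int => x _; case: (f x) => u v /=; ring.
Qed.

Lemma sph_intC_odd d (f : 'rV[R]_d.+1 -> R[i]) :
  (forall x, on_sphere x -> f (- x) = - f x) -> sph_intC d f = 0.
Proof.
by move=> fN; rewrite /sph_intC !sph_int_odd// => x /fN ->; case: (f x).
Qed.

End SphereIntegral.

(** * Parity of spherical harmonics and their gradients *)

Section Parity.
Context {R : realType}.

Lemma hpoly_funN (T : comNzRingType) (emb : R -> T) (n k : nat)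
    (c : {ffun 'I_n -> 'I_k.+1} -> T) (x : 'rV[R]_n) :
    (forall r, emb (- r) = - emb r) ->
  hpoly_fun emb c (- x) = (-1) ^+ odd k * hpoly_fun emb c x.
Proof.
move=> embN; rewrite /hpoly_fun mulr_sumr; apply: eq_bigr => a /eqP ak.
(* The exponents of each monomial sum to [k], so its total sign can be distributed over the
   factors. *)
have -> : (-1) ^+ odd k = \prod_i (-1) ^+ a i :> T by rewrite prodrXr ak signr_odd.
rewrite mulrCA; congr (_ * _); rewrite -big_split/=; apply: eq_bigr => i _.
rewrite mxE embN; exact: exprNn.
Qed.

Lemma real_sph_harmN d k (Y : 'rV[R]_d.+1 -> R) (x : 'rV[R]_d.+1) :
  real_sph_harm d k Y -> on_sphere x -> Y (- x) = (-1) ^+ odd k * Y x.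
Proof.
move=> [c [_ Yc]] xS; rewrite !Yc//; last exact: on_sphereN.
exact: hpoly_funN.
Qed.

Lemma cplx_sph_harmN d k (Y : 'rV[R]_d.+1 -> R[i]) (x : 'rV[R]_d.+1) :
  cplx_sph_harm d k Y -> on_sphere x -> Y (- x) = (-1) ^+ odd k * Y x.
Proof.
move=> [c [_ [_ Yc]]] xS; rewrite !Yc//; last exact: on_sphereN.
by apply: hpoly_funN => r; rewrite rmorphN.
Qed.

(** The gradient of the odd [rho] is even, so the sign is that of the gradient of [Y], opposite to
    the parity of [Y]. *)
Lemma sph_grad_dotN d k (rho : 'rV[R]_d.+1 -> R) (Y : 'rV[R]_d.+1 -> R[i])
    (x : 'rV[R]_d.+1) :
    (forall y, on_sphere y -> rho (- y) = - rho y) ->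
    cplx_sph_harm d k Y -> on_sphere x ->
  sph_grad_dot rho Y (- x) = - (-1) ^+ odd k * sph_grad_dot rho Y x.
Proof.
move=> rhoN hY xS; rewrite /sph_grad_dot mulr_sumr; apply: eq_bigr => i _.
have s0 : (-1) ^+ odd k != 0 :> R by rewrite signr_eq0.
rewrite (@sph_gradN _ _ rho (-1))//; last first.
  by move=> y /rhoN ->; rewrite mulN1r.
rewrite !(@sph_gradN _ _ _ ((-1) ^+ odd k))//; last 2 first.
- move=> y yS; rewrite (cplx_sph_harmN hY yS).
  by case: (odd k); rewrite ?expr0 ?expr1 ?mul1r ?mulN1r//; case: (Y y).
- move=> y yS; rewrite (cplx_sph_harmN hY yS).
  by case: (odd k); rewrite ?expr0 ?expr1 ?mul1r ?mulN1r//; case: (Y y).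
rewrite opprK mul1r mulrCA; congr (_ * _).
by case: (odd k); rewrite ?expr0 ?expr1 ?opprK ?mul1r ?mulN1r.
Qed.

End Parity.

(** * The matrix in the constant and odd cases *)

Section Spectrum.
Context {R : realType}.

Lemma Mmat_cst d k (rho : 'rV[R]_d.+1 -> R) (a : R)
    (Y : 'I_(Ndim d k) -> 'rV[R]_d.+1 -> R[i]) :
    (forall x, on_sphere x -> rho x = a) -> cplx_ONB d k Y ->
  Mmat d k rho Y = ((- (k%:R * a))%:C)%:M.
Proof.
move=> rhoa [_ [Yorth _]]; apply/matrixP => m n; rewrite !mxE.
rewrite (@eq_sph_intC _ _ _ (fun x => (k%:R * a)%:C * (Y m x * (Y n x)^*))); last first.
  by move=> x xS; rewrite rhoa// mulrA.
(* Writing the zero integrand as a product lets homogeneity show that its integral vanishes. *)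
rewrite sph_intCZ Yorth (@eq_sph_intC _ _ _ (fun x => 0%:C * 0)); last first.
  move=> x xS; rewrite mulr0 /sph_grad_dot big1 ?mul0r// => i _.
  by rewrite (sph_grad_cst _ rhoa)// mul0r.
by rewrite sph_intCZ mul0r subr0 mulr_natr rmorphN mulNrn.
Qed.

Lemma Mmat_odd d k p (rho : 'rV[R]_d.+1 -> R)
    (Y : 'I_(Ndim d k) -> 'rV[R]_d.+1 -> R[i]) :
    odd p -> real_sph_harm d p rho -> (forall m, cplx_sph_harm d k (Y m)) ->
  Mmat d k rho Y = 0.
Proof.
move=> podd hrho hY; apply/matrixP => m n; rewrite !mxE.
have rhoN x : on_sphere x -> rho (- x) = - rho x.
  by move=> /(real_sph_harmN hrho) ->; rewrite podd expr1 mulN1r.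
rewrite !sph_intC_odd ?oppr0 ?addr0// => x xS.
(* Gradient term first, then the term in [rho]: in each, the two factors [(-1) ^+ odd k] cancel and
   one minus sign remains. *)
- rewrite (sph_grad_dotN rhoN (hY m) xS) (cplx_sph_harmN (hY n) xS).
  by case: (odd k); rewrite ?expr0 ?expr1 ?opprK ?mul1r ?mulN1r ?rmorphN ?mulrN ?mulNr.
- rewrite rhoN// (cplx_sph_harmN (hY n) xS) (cplx_sph_harmN (hY m) xS).
  by case: (odd k); rewrite ?expr0 ?expr1 ?mul1r ?mulN1r !(rmorphN, mulrN, mulNr) ?opprK.
Qed.

Lemma char_poly_scalar (T : comNzRingType) n (a : T) :
  char_poly (a%:M : 'M[T]_n) = ('X - a%:P) ^+ n.
Proof. by rewrite /char_poly /char_poly_mx map_scalar_mx -raddfB det_scalar. Qed.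

End Spectrum.

(* rho = Y_{p',q'}; M = M^{(d,k)} built from the complex ONB Yc of degree-k
   harmonics; its eigenvalues (with multiplicity) are the lambda^{(1)}_{k,j}. *)
Theorem theorem5p4 (R : realType) (d : nat) (hd : (3 <= d)%N)
  (Yr : forall p : nat, 'I_(Ndim d p) -> 'rV[R]_d.+1 -> R)
  (hYr : forall p : nat, real_ONB d p (Yr p))
  (hY0 : forall (q : 'I_(Ndim d 0)) (x : 'rV[R]_d.+1),
           on_sphere x -> Yr 0%N q x = (Num.sqrt (sph_area R d))^-1)
  (p' : nat) (q' : 'I_(Ndim d p'))
  (k : nat) (hk : (0 < k)%N)
  (Yc : 'I_(Ndim d k) -> 'rV[R]_d.+1 -> R[i]) (hYc : cplx_ONB d k Yc) :
  (p' = 0%N ->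
     char_poly (Mmat d k (Yr p' q') Yc)
     = ('X - ((- (k%:R * (Num.sqrt (sph_area R d))^-1))%:C)%:P) ^+ Ndim d k) /\
  (odd p' ->
     char_poly (Mmat d k (Yr p' q') Yc) = 'X^(Ndim d k)).
Proof.
split => [p0|podd].
- subst p'; rewrite (Mmat_cst (a := (Num.sqrt (sph_area R d))^-1) _ hYc).
    exact: char_poly_scalar.
  exact: hY0.
- rewrite (Mmat_odd podd (proj1 (hYr p') q') (proj1 hYc)).
  by rewrite -[0](raddf0 (@scalar_mx _ _)) char_poly_scalar subr0.
Qed.
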